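(* Let $F:\mathbb{R}^n\rightarrow\mathbb{R}^n$ be an injective piecewise affine function. Then $F$ is coherently oriented.
   Context: A continuous function $F:\mathbb{R}^n\rightarrow\mathbb{R}^n$ is piecewise affine if there is a finite set of affine functions $F_i(x)=A_ix+b_i$, called selection functions (with linear part $A_i$), such that for every $x\in\mathbb{R}^n$ one has $F(x)=F_i(x)$ for some $i$. If $F$ coincides with $F_i$ on a set $U$, then $F_i$ is said to be active on $U$. A polyhedral subdivision $\mathcal P(F)$ corresponding to $F$ is a finite collection of $n$-dimensional convex polyhedra covering $\mathbb{R}^n$ such that: (1) for every $P\in\mathcal P(F)$ there is a selection function $F_i$ with $F|_P=F_i|_P$; (2) the intersection of two distinct polyhedra $P,Q\in\mathcal P(F)$ is either empty or a common proper face of $P$ and $Q$; (3) if $P\cap Q\neq\emptyset$, the selection functions active on $P$ and on $Q$ coincide on $P\cap Q$. Every piecewise affine function admits such a (nonunique) subdivision. Convention: every selection function considered is active on some $n$-dimensional polyhedron of a subdivision $\mathcal P(F)$ (redundant selection functions are discarded). $F$ is coherently oriented if the linear parts of its selection functions all have the same nonzero determinant sign. *)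

(* Defs.v *)
From HB Require Import structures.
From mathcomp Require Import all_boot all_order all_algebra.
From mathcomp Require Import all_classical all_reals all_analysis.
Set Implicit Arguments.
Unset Strict Implicit.
Unset Printing Implicit Defensive.
Import Order.TTheory GRing.Theory Num.Theory.
Import numFieldNormedType.Exports.
Local Open Scope classical_set_scope.
Local Open Scope ring_scope.

Definition affine_map (R : realType) (n : nat) (f : 'M[R]_n * 'cV[R]_n)
    (x : 'cV[R]_n) : 'cV[R]_n :=
  f.1 *m x + f.2.

Definition active_on (R : realType) (n : nat) (F : 'cV[R]_n -> 'cV[R]_n)
    (f : 'M[R]_n * 'cV[R]_n) (U : set 'cV[R]_n) : Prop :=
  forall x, U x -> F x = affine_map f x.

Definition selects (R : realType) (n : nat) (F : 'cV[R]_n -> 'cV[R]_n)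
    (sel : seq ('M[R]_n * 'cV[R]_n)) : Prop :=
  forall x, exists2 f, f \in sel & F x = affine_map f x.

Definition piecewise_affine (R : realType) (n : nat)
    (F : 'cV[R]_n -> 'cV[R]_n) : Prop :=
  continuous F /\ exists sel, selects F sel.

Definition polyhedron (R : realType) (n : nat) (P : set 'cV[R]_n) : Prop :=
  exists (k : nat) (M : 'M[R]_(k, n)) (d : 'cV[R]_k),
    P = [set x | forall i, (M *m x) i 0 <= d i 0].

(* [P] contains n+1 affinely independent points [x] and [x + col i V]. *)
Definition full_dimensional (R : realType) (n : nat) (P : set 'cV[R]_n) : Prop :=
  exists (x : 'cV[R]_n) (V : 'M[R]_n),
    [/\ V \in unitmx, P x & forall i, P (x + col i V)].

(* A face is cut out by an inequality [c x <= d] valid on [P]; [c = 0] is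
   allowed, so that [P] and [set0] are faces. *)
Definition face (R : realType) (n : nat) (P Q : set 'cV[R]_n) : Prop :=
  exists (c : 'rV[R]_n) (d : R),
    (forall x, P x -> (c *m x) 0 0 <= d) /\
    Q = P `&` [set x | (c *m x) 0 0 = d].

Definition proper_face (R : realType) (n : nat) (P Q : set 'cV[R]_n) : Prop :=
  face P Q /\ Q <> P.

Definition polyhedral_subdivision (R : realType) (n : nat)
    (F : 'cV[R]_n -> 'cV[R]_n) (sel : seq ('M[R]_n * 'cV[R]_n))
    (C : set (set 'cV[R]_n)) : Prop :=
  [/\ finite_set C
        /\ (forall P, C P -> polyhedron P /\ full_dimensional P),
      \bigcup_(P in C) P = setT,
      (forall P, C P -> exists2 f, f \in sel & active_on F f P),
      (forall P Q, C P -> C Q -> P <> Q ->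
         P `&` Q = set0 \/
         (proper_face P (P `&` Q) /\ proper_face Q (P `&` Q)))
    & (forall P Q, C P -> C Q -> P `&` Q !=set0 ->
         forall f g, f \in sel -> g \in sel ->
         active_on F f P -> active_on F g Q ->
         forall x, (P `&` Q) x -> affine_map f x = affine_map g x)].

(* The selection functions of [F], redundant ones being discarded: they must be
   active on a cell of some subdivision. *)
Definition selection_function (R : realType) (n : nat)
    (F : 'cV[R]_n -> 'cV[R]_n) (f : 'M[R]_n * 'cV[R]_n) : Prop :=
  exists sel, [/\ selects F sel, f \in sel &
    exists C, polyhedral_subdivision F sel C /\
      exists2 P, C P & active_on F f P].

Definition coherently_oriented (R : realType) (n : nat)
    (F : 'cV[R]_n -> 'cV[R]_n) : Prop :=
  exists2 s : R, s != 0 &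
    forall f, selection_function F f -> Num.sg (\det f.1) = s.

(* Main.v *)
(** Join a point where [F] coincides with one selection function to a point
    where it coincides with another by a generic line: at each point of the
    line, all coordinate differences of selection functions vanishing there
    without being identically zero are proportional.  Near such a point [F] is
    either affine or given by two affine maps, of linear parts [A] and [B], on
    the two sides of one hyperplane [l = 0].  In the latter case, if [det A * det B < 0], then
    [(1 - t) A + t B] kills some [v <> 0] with [0 < t < 1]; [v] is transverse
    to the hyperplane, and [(1 - t) A v = - t B v] says that [F] takes the same
    value at [z + e (1 - t) v] and [z - e t v], contradicting injectivity.  So
    the determinant sign is locally constant along the line. *)
Require Import Defs.
From mathcomp Require Import all_boot all_order all_algebra.
From mathcomp Require Import all_classical all_reals all_analysis.
From mathcomp Require Import ring lra.
Set Implicit Arguments.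
Unset Strict Implicit.
Unset Printing Implicit Defensive.
Import Order.TTheory GRing.Theory Num.Theory.
Import numFieldNormedType.Exports.
Local Open Scope classical_set_scope.
Local Open Scope ring_scope.

(** * Affine functionals: generic points and connectedness of a segment *)

Section AffineFunctionals.
Variables (R : realType) (n : nat).
Implicit Types (l : 'cV[R]_n -> R) (x v w : 'cV[R]_n) (U : set 'cV[R]_n).

Definition affine_functional l : Prop :=
  continuous l /\ forall x v t, l (x + t *: v) = l x + t * (l (x + v) - l x).

Lemma nbhs_line w v (t0 : R) U :
  nbhs (w + t0 *: v) U -> \forall t \near t0, U (w + t *: v).
Proof.
move=> Uw.
suff : (fun t : R => w + t *: v) t @[t --> t0] --> w + t0 *: v by apply.
by apply: cvgD; [exact: cvg_cst | apply: cvgZr_tmp; exact: cvg_id].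
Qed.

Lemma nbhs_line0 w v U : nbhs w U -> \forall t \near (0 : R), U (w + t *: v).
Proof. by move=> Uw; apply: nbhs_line; rewrite scale0r addr0. Qed.

Lemma near0_ex_pos (P : set R) : (\forall t \near (0 : R), P t) ->
  exists2 t : R, 0 < t & P t.
Proof.
move=> /nbhs_normP [e /= e0 Pe]; exists (e / 2); first by rewrite divr_gt0.
apply: Pe; rewrite /ball_ /= sub0r normrN gtr0_norm ?divr_gt0 //.
by rewrite ltr_pdivrMr // ltr_pMr // ltr1n.
Qed.

Lemma affine_functional_dense l p w U : affine_functional l -> l p != 0 ->
  nbhs w U -> exists2 y, U y & l y != 0.
Proof.
move=> [_ al] lp Uw; have [lw|lw] := eqVneq (l w) 0; last first.
  by exists w => //; exact: nbhs_singleton.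
have [t t0 Ut] := near0_ex_pos (nbhs_line0 (p - w) Uw).
exists (w + t *: (p - w)) => //.
by rewrite al lw add0r subr0 subrKC mulf_neq0 // gt_eqF.
Qed.

(** Nonvanishing of the functionals already treated is an open condition, so finitely many small
    moves, one per functional, avoid all the zero sets. *)
Lemma affine_functional_generic (I : finType) (l : I -> 'cV[R]_n -> R) w U :
  (forall i, affine_functional (l i)) -> nbhs w U ->
  exists2 y, U y & forall i, (exists p, l i p != 0) -> l i y != 0.
Proof.
move=> al Uw.
suff [y Uy Hy] : exists2 y, U° y &
    forall i, i \in enum I -> (exists p, l i p != 0) -> l i y != 0.
  exists y; first exact: interior_subset Uy.
  by move=> i; apply: Hy; rewrite mem_enum.
elim: (enum I) => [|i s [y Uy Hy]].
  by exists w => //; exact: Uw.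
have [[p lp]|nlp] := pselect (exists p, l i p != 0); last first.
  by exists y => // j; rewrite inE => /predU1P[-> //|]; exact: Hy.
have Vy : nbhs y [set x | U° x /\
    forall j, (j \in s) && `[<exists p, l j p != 0>] -> l j x != 0].
  apply: filterI; first exact: nbhs_interior.
  suff : \forall x \near y, forall j : I, j \in s -> (exists p, l j p != 0) ->
      l j x != 0.
    by apply: filterS => x Hx j /andP[js /asboolP pj]; exact: Hx.
  apply: (@filter_forall _ _ (fun j x => j \in s -> (exists p, l j p != 0) ->
    l j x != 0) (nbhs y) (nbhs_filter y)) => j.
  have [/andP[js /asboolP pj]|njs] :=
      boolP ((j \in s) && `[<exists p, l j p != 0>]); last first.
    apply: nearW => x js /asboolP pj.
    by move: njs; rewrite js pj.
  have lj0 : \forall x \near y, l j x != 0.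
    exact: (@cvgr_neq0 _ _ _ (nbhs y) (nbhs_filter y) (l j) _ ((al j).1 y)
      (Hy j js pj)).
  by apply: filterS lj0 => x ? ? ?.
have [x [Ux Hx] lx] := affine_functional_dense (al i) lp Vy.
exists x => // j; rewrite inE => /predU1P[-> //|js pj].
by apply: Hx; rewrite js; apply/asboolP.
Qed.

Lemma affine_functional_line l x y t : affine_functional l ->
  l (x + t *: (y - x)) = (1 - t) * l x + t * l y.
Proof. by move=> [_ ->]; rewrite subrKC; ring. Qed.

Lemma affine_functional_comb l l' (a b : R) :
  affine_functional l -> affine_functional l' ->
  affine_functional (fun x => a * l x + b * l' x).
Proof.
move=> [cl al] [cl' al']; split; last by move=> x v t; rewrite al al'; ring.
move=> x.
have cM (k : R) (f : 'cV[R]_n -> R) : continuous f ->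
    k * f y @[y --> x] --> k * f x.
  by move=> cf; exact: (@cvgMl_tmp _ _ (nbhs x) (nbhs_filter x) f k _ (cf x)).
exact: (@cvgD _ _ _ (nbhs x) (nbhs_filter x) _ _ _ _ (cM a l cl) (cM b l' cl')).
Qed.

(** Connectedness of the segment: the points around which [s0] holds form a relatively open set, and
    its complement in the segment is covered by the open sets belonging to the other values. *)
Lemma locally_constant (X : Type) (Q : R -> X -> Prop) (s0 s1 : X) :
  (forall t : R, t \in `[0, 1] -> exists s,
    \forall u \near t, u \in `[0, 1] -> Q u s) ->
  (forall (t : R) s s', t \in `[0, 1] -> Q t s -> Q t s' -> s = s') ->
  Q 0 s0 -> Q 1 s1 -> s0 = s1.
Proof.
move=> ex_s uniq_s Q0 Q1.
have i0 : (0 : R) \in `[0, 1] by rewrite in_itv /= lexx ler01.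
have i1 : (1 : R) \in `[0, 1] by rewrite in_itv /= lexx ler01.
pose W s := [set u : R | u \in `[0, 1] -> Q u s].
suff EB : `[0, 1]%classic `&` (W s0)° = `[0, 1]%classic.
  have : (`[0, 1]%classic `&` (W s0)°) (1 : R) by rewrite EB.
  by move=> [_ /interior_subset /(_ i1)] Q1'; exact: uniq_s Q1' Q1.
have opn (t : R) : t \in `[0, 1] -> forall s, Q t s -> (W s)° t.
  move=> ti s Qts; have [s' Hs'] := ex_s t ti.
  suff -> : s = s' by exact: Hs'.
  exact: uniq_s Qts (nbhs_singleton Hs' ti).
apply: (@segment_connected R 0 1).
- by exists 0; split => //; exact: opn.
- by exists (W s0)° => //; exact: open_interior.
- exists (~` (\bigcup_(s in [set s | s <> s0]) (W s)°)).
    apply: open_closedC; apply: bigcup_open => s _; exact: open_interior.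
  apply/seteqP; split => t [ti Ht]; split => //.
    move=> [s /= ss0 Wst]; apply: ss0.
    exact: uniq_s (interior_subset Wst ti) (interior_subset Ht ti).
  have [s Hs] := ex_s t ti.
  have Qts := nbhs_singleton Hs ti.
  have [<-//|ss0] := pselect (s = s0).
  by exfalso; apply: Ht; exists s.
Qed.

End AffineFunctionals.

(** * Affine maps: coordinate differences and pencils of linear parts *)

Section AffineMaps.
Variables (R : realType) (n : nat).
Implicit Types (f g h : 'M[R]_n * 'cV[R]_n) (x v w z : 'cV[R]_n).

Lemma affine_map_line f x v t :
  affine_map f (x + t *: v) = affine_map f x + t *: (f.1 *m v).
Proof. by rewrite /affine_map mulmxDr -scalemxAr addrAC. Qed.

Lemma affine_map_coord_continuous f k :
  continuous (fun x => affine_map f x k 0).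
Proof.
move=> x; rewrite /affine_map; under eq_fun do rewrite !mxE.
apply: (@cvgD _ _ _ (nbhs x) (nbhs_filter x)); last exact: cvg_cst.
apply: (@continuous_big _ _ _ _ _ add_continuous) => j _ y.
exact: (@cvgMl_tmp _ _ (nbhs y) (nbhs_filter y) _ _ _
  (@coord_continuous _ _ _ j 0 y)).
Qed.

Lemma affine_map_inj f g : (forall x, affine_map f x = affine_map g x) -> f = g.
Proof.
case: f g => [A a] [B b] fg.
have ab : a = b by have := fg 0; rewrite /affine_map !mulmx0 !add0r.
congr pair => //; apply/matrixP => i j.
have := fg (delta_mx j 0); rewrite /affine_map /= ab => /addIr.
by rewrite -!colE => /matrixP /(_ i 0); rewrite !mxE.
Qed.

(** Taken coordinatewise to get scalar functionals: the zero set of a nontrivial one is empty or a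
    hyperplane (a wall). *)
Definition coord_diff f g (k : 'I_n) x : R :=
  affine_map f x k 0 - affine_map g x k 0.

Lemma coord_diff_affine f g k : affine_functional (coord_diff f g k).
Proof.
split=> [x|x v t]; last first.
  rewrite /coord_diff !affine_map_line -{3 4}(scale1r v) !affine_map_line.
  by rewrite !mxE; ring.
exact: (@cvgB _ _ _ (nbhs x) (nbhs_filter x) _ _ _ _
  (@affine_map_coord_continuous f k x) (@affine_map_coord_continuous g k x)).
Qed.

Lemma affine_map_coordP f g x :
  (forall k, coord_diff f g k x = 0) <-> affine_map f x = affine_map g x.
Proof.
split=> [H|H k]; last by rewrite /coord_diff H subrr.
apply/matrixP => k j; rewrite (ord1 j).
by apply/eqP; rewrite -subr_eq0; apply/eqP/H.
Qed.

Lemma coord_diff_neq0 f g :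
  f <> g -> exists k p, coord_diff f g k p != 0.
Proof.
move=> fg; apply: contrapT => H; apply: fg; apply: affine_map_inj => x.
apply/affine_map_coordP => k; apply/eqP/negPn/negP => kx.
by apply: H; exists k, x.
Qed.

(** The determinant changes sign on the segment from [A] to [B], so by the intermediate value
    theorem it vanishes strictly inside; [v] is a kernel vector there. *)
Lemma det_opposite_pencil (A B : 'M[R]_n) : \det A * \det B < 0 ->
  exists v t, [/\ v != 0, 0 < t, t < 1 & (1 - t) *: (A *m v) = - t *: (B *m v)].
Proof.
move=> AB.
pose M t := A + t *: (B - A).
have cM : continuous (fun t => \det (M t)).
  apply: (@continuous_big _ _ _ _ _ add_continuous) => s _ t.
  apply: cvgMl_tmp; move: t.
  apply: (@continuous_big _ _ _ _ _ mul_continuous) => i _ t.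
  rewrite /M; under eq_fun do rewrite !mxE.
  by apply: cvgD; [exact: cvg_cst | apply: cvgMr_tmp; exact: cvg_id].
have M0 : M 0 = A by rewrite /M scale0r addr0.
have M1 : M 1 = B by rewrite /M scale1r subrKC.
have [||t] := @IVT R (fun t => \det (M t)) 0 1 0 ler01.
- exact: continuous_subspaceT.
- rewrite M0 M1 ge_min le_max.
  by case: ltgtP AB => // ?; case: ltgtP => // ?; nra.
rewrite in_itv /= => /andP[t0 t1] Mt.
have tn0 : t != 0.
  by apply/eqP => te; move: Mt AB; rewrite te M0 => ->; rewrite mul0r ltxx.
have tn1 : t != 1.
  by apply/eqP => te; move: Mt AB; rewrite te M1 => ->; rewrite mulr0 ltxx.
have /eqP := Mt; rewrite -det_tr => /det0P [v v0 Mv].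
have {}Mv : M t *m v^T = 0 by rewrite -[LHS]trmxK trmx_mul trmxK Mv trmx0.
exists v^T, t; split.
- by apply: contra v0 => /eqP v0; rewrite -[v]trmxK v0 trmx0.
- by rewrite lt_neqAle eq_sym tn0.
- by rewrite lt_neqAle tn1.
apply/eqP; rewrite -subr_eq0 -Mv /M !mulmxDl -scalemxAl mulmxDl mulNmx; apply/eqP.
by rewrite scalerDr scalerBl scale1r scalerN scaleNr opprK addrAC addrA.
Qed.

End AffineMaps.

(** * Affine germs of [F] and the signs of their determinants *)

Section InjectivePiecewiseAffine.
Variables (R : realType) (n : nat) (F : 'cV[R]_n -> 'cV[R]_n).
Implicit Types (h : 'M[R]_n * 'cV[R]_n) (x v w z : 'cV[R]_n).

(** Agreement on a whole neighbourhood determines [h], whereas several maps may agree with [F] at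
    the single point [w]. *)
Definition germ h w : Prop := \forall x \near w, F x = affine_map h x.

Lemma germ_unique h h' w : germ h w -> germ h' w -> h = h'.
Proof.
move=> gh gh'; apply: contrapT => /coord_diff_neq0 [k [p kp]].
have [y [hy hhy] hy'] := affine_functional_dense (coord_diff_affine h h' k) kp
  (filterI gh gh').
by move/eqP: hy'; apply; apply: (affine_map_coordP h h' y).2; rewrite -hy -hhy.
Qed.

Hypothesis inj_F : injective F.

(** A kernel vector of [h.1] would be a direction in which [F] is constant near [w]. *)
Lemma germ_det_neq0 h w : germ h w -> \det h.1 != 0.
Proof.
move=> gh; apply/negP; rewrite -det_tr => /det0P [v v0 hv].
have {}hv : h.1 *m v^T = 0 by rewrite -[LHS]trmxK trmx_mul trmxK hv trmx0.
have [t t0 ht] := near0_ex_pos (nbhs_line0 v^T gh).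
have /inj_F : F (w + t *: v^T) = F w.
  by rewrite ht affine_map_line hv scaler0 addr0 (nbhs_singleton gh).
move=> /eqP; rewrite -subr_eq0 addrAC subrr add0r scaler_eq0 gt_eqF //=.
by apply/negP; apply: contra v0 => /eqP v0; rewrite -[v]trmxK v0 trmx0.
Qed.

Hypothesis cont_F : continuous F.
Variables (I : finType) (f : I -> 'M[R]_n * 'cV[R]_n).
Hypothesis selF : forall x, exists i, F x = affine_map (f i) x.

(** By continuity, each of the finitely many maps that differ from [F] at [z] still differs from it
    near [z]. *)
Lemma near_active z : \forall w \near z, forall i,
  F w = affine_map (f i) w -> F z = affine_map (f i) z.
Proof.
apply: (@filter_forall _ _ (fun i w => F w = affine_map (f i) w ->
  F z = affine_map (f i) z) (nbhs z) (nbhs_filter z)) => i.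
have [Fz|Fz] := pselect (F z = affine_map (f i) z); first exact: nearW.
have [k kz] : exists k, F z k 0 - affine_map (f i) z k 0 != 0.
  apply: contrapT => H; apply: Fz; apply/matrixP => k j; rewrite (ord1 j).
  apply/eqP; rewrite -subr_eq0; apply/negPn/negP => kz; apply: H.
  by exists k.
have ck : (F w k 0 - affine_map (f i) w k 0) @[w --> z] -->
    F z k 0 - affine_map (f i) z k 0.
  apply: (@cvgB _ _ _ (nbhs z) (nbhs_filter z)).
    exact: (continuous_comp (@cont_F z) (@coord_continuous _ _ _ k 0 (F z))).
  exact: (@affine_map_coord_continuous _ _ (f i) k z).
have := @cvgr_neq0 _ _ _ (nbhs z) (nbhs_filter z) _ _ ck kz.
by apply: filterS => w + Fw; rewrite Fw subrr eqxx.
Qed.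

(** In a small half ball only maps active at [z] occur, and by the last hypothesis distinct ones
    never meet there. The half ball is convex, so the active map is constant along segments in it.
    Maps are compared, not indices, since [f] may repeat. *)
Lemma half_ball_active z p (l : 'cV[R]_n -> R) :
  affine_functional l -> l z = 0 -> 0 < l p ->
  (forall i j w, F z = affine_map (f i) z -> F z = affine_map (f j) z ->
     0 < l w -> affine_map (f i) w = affine_map (f j) w -> f i = f j) ->
  exists2 i, F z = affine_map (f i) z &
    \forall w \near z, 0 < l w -> F w = affine_map (f i) w.
Proof.
move=> al lz lp sep.
have /nbhs_normP [r /= r0 Br] := near_active z.
(* A base point of the half ball, reached from [z] by a small move towards [p]. *)
have [t t0 Bw0] : exists2 t, 0 < t & ball_ Num.norm z r (z + t *: (p - z)).
  apply: near0_ex_pos; apply: nbhs_line0; apply: (nbhs_normP z _).2.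
  by exists r.
pose w0 := z + t *: (p - z).
have lw0 : 0 < l w0.
  by rewrite /w0 affine_functional_line // lz mulr0 add0r mulr_gt0.
have [i0 Fi0] := selF w0.
exists i0; first exact: Br Fi0.
apply: (nbhs_normP z _).2; exists r => // w /= Bw lw.
pose c u := w0 + u *: (w - w0).
have Bc u : u \in `[0, 1] -> ball_ Num.norm z r (c u).
  rewrite in_itv /= => /andP[u0 u1].
  have -> : z - c u = (1 - u) *: (z - w0) + u *: (z - w).
    by apply/matrixP => i j; rewrite !mxE; ring.
  apply: le_lt_trans (ler_normD _ _) _.
  rewrite !normrZ (ger0_norm u0) (ger0_norm (_ : 0 <= 1 - u)) ?subr_ge0 //.
  move: Bw0 Bw; rewrite /ball_ /= -/w0.
  move: `|z - w0| `|z - w| => a b ar br.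
  have [->|un0] := eqVneq u 0; first by rewrite subr0 mul1r mul0r addr0.
  have : 0 < u by rewrite lt_neqAle eq_sym un0.
  nra.
have lc u : u \in `[0, 1] -> 0 < l (c u).
  rewrite in_itv /= => /andP[u0 u1].
  rewrite affine_functional_line //.
  have [->|un0] := eqVneq u 0; first by rewrite subr0 mul1r mul0r addr0.
  have : 0 < u by rewrite lt_neqAle eq_sym un0.
  nra.
have c1 : c 1 = w by rewrite /c scale1r subrKC.
have c0 : c 0 = w0 by rewrite /c scale0r addr0.
have [i1 Fi1] := selF w.
(* [h] must also be active at [z], since [sep] compares only such maps. *)
pose Q u h := (exists2 j, f j = h & F z = affine_map (f j) z) /\
  F (c u) = affine_map h (c u).
suff -> : f i0 = f i1 by [].
apply: (@locally_constant R _ Q).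
- move=> u ui; have [j Fj] := selF (c u).
  exists (f j); have := nbhs_line (near_active (c u)).
  apply: filterS => s /= Hs si; have [k Fk] := selF (c s).
  have zj := Br _ (Bc u ui) _ Fj; have zk := Br _ (Bc s si) _ Fk.
  split; first by exists j.
  suff <- : f k = f j by [].
  by apply: sep (lc u ui) _ => //; rewrite -Fj -Hs.
- move=> u _ _ ui [[j <- zj] Fj] [[k <- zk] Fk].
  by apply: sep (lc u ui) _ => //; rewrite -Fj.
- by split; [exists i0 => //; exact: Br Fi0 | rewrite c0].
- by split; [exists i1 => //; exact: Br Fi1 | rewrite c1].
Qed.

Lemma same_sign_across z p (l : 'cV[R]_n -> R) h h' :
  affine_functional l -> l z = 0 -> 0 < l p ->
  F z = affine_map h z -> F z = affine_map h' z ->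
  (forall w, l w = 0 -> affine_map h w = affine_map h' w) ->
  (\forall w \near z, 0 < l w -> F w = affine_map h w) ->
  (\forall w \near z, l w < 0 -> F w = affine_map h' w) ->
  \det h.1 != 0 -> \det h'.1 != 0 ->
  Num.sg (\det h.1) = Num.sg (\det h'.1).
Proof.
move=> al lz lp zh zh' hyp Hp Hm d0 d0'.
have [dd|dd|dd] := ltgtP (\det h.1 * \det h'.1) 0; last 2 first.
- move: dd; case: (sgrP (\det h.1)) d0; case: (sgrP (\det h'.1)) d0' => //; nra.
- by have := mulf_neq0 d0 d0'; rewrite dd eqxx.
have [v [t [v0 t0 t1 hv]]] := det_opposite_pencil dd.
have lzv w s : l (z + s *: w) = s * l (z + w) by rewrite al.2 lz subr0 add0r.
(* Up to sign, [v] points to the positive side. It cannot be parallel to the wall: there [h.1] and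
   [h'.1] agree on [v], and the pencil relation would give [h'.1 *m v = 0]. *)
have {v v0 hv} [v [v0 hv lv]] : exists v, [/\ v != 0,
    (1 - t) *: (h.1 *m v) = - t *: (h'.1 *m v) & 0 < l (z + v)].
  have [lv|lv|lv] := ltgtP (l (z + v)) 0.
  - exists (- v); rewrite oppr_eq0 !mulmxN !scalerN hv.
    by split => //; rewrite -scaleN1r lzv mulN1r oppr_gt0.
  - by exists v.
  exfalso; have := hyp _ lv.
  rewrite -(scale1r v) !affine_map_line -zh -zh' !scale1r.
  move=> /addrI eqv; move: hv; rewrite eqv => /eqP.
  rewrite -subr_eq0 -scalerBl opprK subrK scale1r.
  rewrite -trmx_eq0 trmx_mul => /eqP hv.
  move: d0'; rewrite -det_tr => /negP; apply; apply/det0P; exists v^T => //.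
  by rewrite trmx_eq0.
have [e e0 [/= He He']] := near0_ex_pos (filterI
  (nbhs_line0 ((1 - t) *: v) Hp) (nbhs_line0 (- t *: v) Hm)).
have : F (z + e *: ((1 - t) *: v)) = F (z + e *: (- t *: v)).
  rewrite He; last by rewrite lzv lzv !mulr_gt0 // subr_gt0.
  rewrite He'; last by rewrite lzv lzv mulNr mulrN oppr_lt0 !mulr_gt0.
  by rewrite !affine_map_line -zh -zh' -!scalemxAr hv.
(* The two points differ by [e *: v], which is nonzero. *)
move=> /inj_F /addrI /eqP.
rewrite -subr_eq0 -scalerBr -scalerBl opprK subrK scale1r.
by rewrite scaler_eq0 (gt_eqF e0) (negPf v0).
Qed.

Lemma half_space_germ z (l : 'cV[R]_n -> R) h : continuous l ->
  (\forall w \near z, 0 < l w -> F w = affine_map h w) ->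
  \forall w \near z, 0 < l w -> germ h w.
Proof.
move=> cl /near_join; apply: filterS => w Hw lw.
have lw' : \forall x \near w, 0 < l x.
  exact: (@cvgr_gt _ _ (nbhs w) (nbhs_filter w) _ _ (cl w) _ lw).
by rewrite /germ; apply: filterS2 Hw lw' => x; apply.
Qed.

(** At most one wall passes through [z]. *)
Definition proportional_zeros z : Prop := forall i j k i' j' k',
  let l := coord_diff (f i) (f j) k in let l' := coord_diff (f i') (f j') k' in
  l z = 0 -> l' z = 0 -> (exists p, l p != 0) -> (exists p, l' p != 0) ->
  exists2 c, c != 0 & forall x, l' x = c * l x.

(** Germs need not exist on the wall itself, so the sign is asserted for every germ at every point
    near [z]. *)
Lemma local_sign z : proportional_zeros z ->
  exists s, \forall w \near z, forall h, germ h w -> Num.sg (\det h.1) = s.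
Proof.
move=> prop_z.
have cz a b k : F z = affine_map (f a) z -> F z = affine_map (f b) z ->
    coord_diff (f a) (f b) k z = 0.
  by move=> Fa Fb; apply: (affine_map_coordP _ _ _).2; rewrite -Fa.
(* If all maps active at [z] are equal, [F] is affine near [z]. *)
have [[i [j [Fi Fj fij]]]|all_eq] := pselect (exists i j,
    [/\ F z = affine_map (f i) z, F z = affine_map (f j) z & f i <> f j]);
    last first.
  have [i Fi] := selF z; exists (Num.sg (\det (f i).1)).
  have gi : germ (f i) z.
    apply: filterS (near_active z) => w Hw; have [j Fj] := selF w.
    suff -> : f i = f j by [].
    by apply: contrapT => fij; apply: all_eq; exists i, j; split; [|exact: Hw|].
  by apply: filterS (near_join gi) => w gw h hw; rewrite (germ_unique hw gw).
have {fij} [{}i [{}j [k [p [{}Fi {}Fj lp]]]]] : exists i j k p,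
    [/\ F z = affine_map (f i) z, F z = affine_map (f j) z &
        0 < coord_diff (f i) (f j) k p].
  have [k [p]] := coord_diff_neq0 fij.
  rewrite neq_lt => /orP[lp|lp]; last by exists i, j, k, p.
  by exists j, i, k, p; split => //; rewrite /coord_diff -opprB oppr_gt0.
pose l := coord_diff (f i) (f j) k.
(* The opposite functional lets [half_ball_active] treat the side [l < 0]; the reflection of [p] in
   [z] lies there. *)
pose l' := coord_diff (f j) (f i) k.
have l'E w : l' w = - l w by rewrite /l' /l /coord_diff opprB.
have al : affine_functional l by exact: coord_diff_affine.
have al' : affine_functional l' by exact: coord_diff_affine.
have lz : l z = 0 by exact: cz.
have l'z : l' z = 0 by exact: cz.
have l'p : 0 < l' (z + - 1 *: (p - z)).
  by rewrite l'E affine_functional_line // lz; move: lp; rewrite -/l; lra.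
have sep a b w : F z = affine_map (f a) z -> F z = affine_map (f b) z ->
    l w != 0 -> affine_map (f a) w = affine_map (f b) w -> f a = f b.
  move=> Fa Fb lw fw; apply: contrapT => /coord_diff_neq0 [k' [p' kp']].
  have [||c c0 Hc] := prop_z i j k a b k' (cz _ _ _ Fi Fj) (cz _ _ _ Fa Fb).
  - by exists p; rewrite gt_eqF.
  - by exists p'.
  have := (affine_map_coordP (f a) (f b) w).2 fw k'.
  by rewrite Hc => /eqP; rewrite mulf_eq0 (negPf c0) (negPf lw).
have [a Fa Ha] := @half_ball_active z p l al lz lp
  (fun a b w Fa Fb lw => sep a b w Fa Fb (lt0r_neq0 lw)).
have [|b Fb Hb] := @half_ball_active z _ l' al' l'z l'p.
  move=> a' b' w Fa' Fb' lw; apply: sep => //.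
  by rewrite -oppr_eq0 -l'E lt0r_neq0.
have ga := half_space_germ al.1 Ha.
have gb := half_space_germ al'.1 Hb.
have pos_germ q m c : affine_functional m -> m z = 0 -> 0 < m q ->
    (\forall w \near z, 0 < m w -> germ (f c) w) -> \det (f c).1 != 0.
  move=> am mz mq Hm; have [t t0 Ht] := near0_ex_pos (nbhs_line0 (q - z) Hm).
  apply: (@germ_det_neq0 _ (z + t *: (q - z))); apply: Ht.
  by rewrite affine_functional_line // mz mulr0 add0r mulr_gt0.
have sgE : Num.sg (\det (f a).1) = Num.sg (\det (f b).1).
  apply: (@same_sign_across z p l) => //.
  (* A nontrivial coordinate difference of [f a] and [f b] is a multiple of [l], hence zero on the
     wall. *)
  - move=> w lw; have [->//|/coord_diff_neq0 [k1 [p1 kp1]]] := pselect (f a = f b).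
    apply/affine_map_coordP => k'.
    apply/eqP/negPn/negP => kw.
    have [||c c0 Hc] := prop_z i j k a b k' (cz _ _ _ Fi Fj) (cz _ _ _ Fa Fb).
    + by exists p; rewrite gt_eqF.
    + by exists w.
    by move: kw; rewrite Hc -/l lw mulr0 eqxx.
  - by apply: filterS Hb => w Hw lw; apply: Hw; rewrite l'E oppr_gt0.
  - exact: pos_germ al lz lp ga.
  - exact: pos_germ al' l'z l'p gb.
exists (Num.sg (\det (f a).1)).
apply: filterS2 (near_join ga) (near_join gb) => w ga' gb' h gh.
(* [w] may lie on the wall; [h] is still a germ at some [y] off it, where uniqueness identifies it
   with [f a] or [f b]. *)
have [|y [[gya gyb] ghy] ly] := @affine_functional_dense _ _ l p w _ al _
  (filterI (filterI ga' gb') (near_join gh)).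
  by rewrite lt0r_neq0.
move: ly; rewrite neq_lt => /orP[ly|ly].
  by rewrite sgE (germ_unique ghy (gyb _)) // l'E oppr_gt0.
by rewrite (germ_unique ghy (gya ly)).
Qed.

(** At a point off all walls, all active maps are equal. *)
Lemma germ_dense z U : nbhs z U -> exists w h, U w /\ germ h w.
Proof.
move=> Uz; have [y Uy Hy] := affine_functional_generic
  (fun t : I * I * 'I_n => coord_diff_affine (f t.1.1) (f t.1.2) t.2) Uz.
have [i Fi] := selF y; exists y, (f i); split => //.
apply: filterS (near_active y) => w Hw; have [j Fj] := selF w.
suff -> : f i = f j by [].
apply: contrapT => /coord_diff_neq0 [k pk].
have /negP := Hy (i, j, k) pk; apply; apply/eqP.
by apply: (affine_map_coordP _ _ _).2; rewrite -Fi (Hw j).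
Qed.

(** Having a given germ is an open condition, so [p] and [q] may be moved to generic [x] and [y]
    whose line meets at most one wall at a time. *)
Lemma germ_same_sign p q g g' : germ g p -> germ g' q ->
  Num.sg (\det g.1) = Num.sg (\det g'.1).
Proof.
move=> gp gq.
pose l (t : I * I * 'I_n) := coord_diff (f t.1.1) (f t.1.2) t.2.
have al t : affine_functional (l t) by exact: coord_diff_affine.
have [x gx Hx] := affine_functional_generic al (near_join gp).
have [y gy Hy] := affine_functional_generic
  (fun t : _ * _ => affine_functional_comb (l t.1 x) (- l t.2 x) (al t.2) (al t.1))
  (near_join gq).
pose c t := x + t *: (y - x).
(* [y] avoids the zeros of [l a x * l b - l b x * l a] whenever this is not
   identically zero, i.e. unless [l a] and [l b] are proportional. *)
have prop_c t : proportional_zeros (c t).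
  move=> i j k i' j' k' /=.
  rewrite -/(l (i, j, k)) -/(l (i', j', k')).
  move: (i, j, k) (i', j', k') => a b la lb na nb.
  have ax := Hx a na; have bx := Hx b nb.
  (* The factor is read off at [x], where neither functional vanishes. *)
  exists (l b x / l a x); first by rewrite mulf_neq0 ?invr_neq0.
  move=> w; apply: (mulfI ax); rewrite mulrA mulrCA divff // mulr1.
  apply/eqP; rewrite -subr_eq0 -mulNr; apply/negPn/negP => Dw.
  (* The combination vanishes at [x] by construction and at [c t] by [la] and [lb]; as [t != 0], it
     vanishes at [y] too. *)
  move/negP: (Hy (a, b) (ex_intro _ w Dw)); apply.
  move: la lb; rewrite /c !affine_functional_line //= => la lb.
  have [t0|t0] := eqVneq t 0.
    by move: la; rewrite t0 subr0 mul1r mul0r addr0 => la; rewrite la eqxx in ax.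
  apply/eqP/(mulfI t0); rewrite mulr0.
  have -> : t * (l a x * l b y + - l b x * l a y) =
    l a x * ((1 - t) * l b x + t * l b y) - l b x * ((1 - t) * l a x + t * l a y).
    by ring.
  by rewrite la lb !mulr0 subr0.
(* Stated on a neighbourhood because [c t] may carry no germ; [germ_dense] then makes [s] unique. *)
pose Q t s := \forall w \near c t, forall h, germ h w -> Num.sg (\det h.1) = s.
have Q_germ h w : germ h w ->
    \forall w' \near w, forall h', germ h' w' ->
      Num.sg (\det h'.1) = Num.sg (\det h.1).
  move=> gh; apply: filterS (near_join gh) => w' gw' h' gh'.
  by rewrite (germ_unique gh' gw').
apply: (@locally_constant R _ Q).
- move=> t _; have [s Hs] := local_sign (prop_c t); exists s.
  by have := nbhs_line (near_join Hs); apply: filterS => u Hu _.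
- move=> t s s' _ Qs Qs'; have [w [h [[Hs Hs'] gh]]] := germ_dense (filterI Qs Qs').
  by rewrite -(Hs h gh) (Hs' h gh).
- by rewrite /Q /c scale0r addr0; exact: Q_germ.
- by rewrite /Q /c scale1r subrKC; exact: Q_germ.
Qed.

End InjectivePiecewiseAffine.

(** * Interior points of full-dimensional cells, and the conclusion *)

Lemma polyhedron_interior (R : realType) (n : nat) (P : set 'cV[R]_n) :
  polyhedron P -> full_dimensional P -> exists p : 'cV[R]_n, nbhs p P.
Proof.
move=> [m [M [d ->]]] [x [V [Vu Px PV]]].
(* [y w] gives the coordinates of [w] in the frame with origin [x] and basis [V]; [p] is the
   barycentre of the simplex. *)
pose y w := affine_map (invmx V, - (invmx V *m x)) w.
pose p := x + V *m const_mx n.+1%:R^-1; exists p.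
have yE : y p = const_mx n.+1%:R^-1.
  by rewrite /y /affine_map /= mulmxDr mulKmx // addrAC subrr add0r.
(* The bound [n%:R^-1] exceeds the value [n.+1%:R^-1] at [p] and still keeps the sum of [n]
   coordinates at most 1, so [w] is a convex combination of the vertices. *)
have : \forall w \near p, forall i, 0 < y w i 0 < n%:R^-1.
  apply: (@filter_forall _ _ (fun i w => 0 < y w i 0 < n%:R^-1)
    (nbhs p) (nbhs_filter p)) => i.
  have cy := @affine_map_coord_continuous R n (invmx V, - (invmx V *m x)) i p.
  have y0 := @cvgr_gt _ _ (nbhs p) (nbhs_filter p) _ _ cy 0.
  have y1 := @cvgr_lt _ _ (nbhs p) (nbhs_filter p) _ _ cy n%:R^-1.
  have n0 : (0 < n)%N by exact: leq_ltn_trans (leq0n i) (ltn_ord i).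
  apply: filterS2 (y0 _) (y1 _) => [w /= -> -> //||]; rewrite -/(y _) yE mxE.
    by rewrite invr_gt0 ltr0n.
  by rewrite ltf_pV2 ?posrE ?ltr0n // ltr_nat.
apply: filterS => w yw i.
have wE : w = x + V *m y w.
  by rewrite /y /affine_map /= mulmxDr mulmxN mulKVmx // mulKVmx // subrKC.
rewrite /= [in X in X <= _]wE.
have y1 : \sum_j y w j 0 <= 1.
  apply: le_trans (_ : \sum_(j < n) n%:R^-1 <= 1).
    by apply: ler_sum => j _; case/andP: (yw j) => _ /ltW.
  rewrite sumr_const card_ord -(mulr_natr n%:R^-1 n).
  (* For [n = 0] the sum is 0. *)
  by have [->|n0] := eqVneq (n%:R : R) 0; rewrite ?mulr0 ?ler01 // mulVf.
have -> : (M *m (x + V *m y w)) i 0 = (1 - \sum_j y w j 0) * (M *m x) i 0 +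
    \sum_j y w j 0 * (M *m (x + col j V)) i 0.
  have -> : \sum_j y w j 0 * (M *m (x + col j V)) i 0 =
      \sum_j (y w j 0 * (M *m x) i 0 + y w j 0 * (M *m V) i j).
    apply: eq_bigr => j _; rewrite -mulrDr mulmxDr colE mulmxA -colE; congr (_ * _).
    by rewrite mxE [X in _ + X]mxE.
  rewrite big_split /= -mulr_suml mulrBl mul1r addrA subrK mulmxDr mxE mulmxA.
  by congr (_ + _); rewrite mxE; apply: eq_bigr => j _; rewrite mulrC.
have -> : d i 0 = (1 - \sum_j y w j 0) * d i 0 + \sum_j y w j 0 * d i 0.
  by rewrite -mulr_suml mulrBl mul1r subrK.
apply: lerD; first by rewrite ler_wpM2l ?subr_ge0.
apply: ler_sum => j _; apply: ler_wpM2l; last exact: PV.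
by case/andP: (yw j) => /ltW.
Qed.

Theorem proposition3p8 (R : realType) (n : nat) (F : 'cV[R]_n -> 'cV[R]_n)
    (hF : piecewise_affine F) (inj_F : injective F) :
  coherently_oriented F.
Proof.
have [cF [sel selF]] := hF.
have selF' x : exists i, F x = affine_map (tnth (in_tuple sel) i) x.
  by have [g /(tnthP (in_tuple sel)) [i ->] Fx] := selF x; exists i.
(* [g] may come from a list other than [sel]; an interior point of its cell turns it into a germ, a
   notion independent of the list. *)
have germ_sel g : selection_function F g -> exists p, germ F g p.
  move=> [sel' [_ _ [C [[[_ CP] _ _ _ _] [P /CP [polyP fullP] FP]]]]].
  have [p Pp] := polyhedron_interior polyP fullP; exists p.
  exact: filterS Pp.
have [[f0 /germ_sel [p0 g0]]|no_sel] := pselect (exists g, selection_function F g).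
  exists (Num.sg (\det f0.1)); first by rewrite sgr_eq0 (germ_det_neq0 inj_F g0).
  by move=> g /germ_sel [p gp]; exact: germ_same_sign gp g0.
by exists 1; [exact: oner_neq0 | move=> g ?; case: no_sel; exists g].
Qed.
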